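(* Let $r\ge 2$ be an integer, let $A$ be a nonnegative $r$-potent real square matrix with $\operatorname{rank}(A)>r-1$, and let $B$ be a non-zero nonnegative idempotent real square matrix. Then the Kronecker product $A\otimes B$ is a decomposable $r$-potent matrix.
   Context: A real matrix is nonnegative if all its entries are $\ge 0$. A square matrix $A$ is $r$-potent if $A^r=A$, and idempotent if $A^2=A$. A real square matrix $A$ is decomposable if there is a permutation matrix $P$ such that $P^{-1}AP=\begin{pmatrix} B' & C'\\ 0 & D'\end{pmatrix}$ with $B'$ and $D'$ square (of positive size). *)

(* Defs.v *)
From mathcomp Require Import all_boot all_order all_algebra.
From mathcomp Require Import reals.

Set Implicit Arguments.
Unset Strict Implicit.
Unset Printing Implicit Defensive.

Import GRing.Theory Num.Theory.

Local Open Scope ring_scope.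

Definition rpotent (R : realType) (r n : nat) (A : 'M[R]_n) : Prop :=
  A ^+ r = A.

Definition idempotent_mx (R : realType) (n : nat) (A : 'M[R]_n) : Prop :=
  A ^+ 2 = A.

(* [castmx] only transports the block matrix along the equation p + q = n. *)
Definition decomposable (R : realType) (n : nat) (A : 'M[R]_n) : Prop :=
  exists (p q : nat) (e : (p + q)%N = n) (P : 'M[R]_n)
         (B' : 'M[R]_p) (C' : 'M[R]_(p, q)) (D' : 'M[R]_q),
    [/\ (0 < p)%N, (0 < q)%N, is_perm_mx P &
        invmx P *m A *m P = castmx (e, e) (block_mx B' C' 0 D')].

(* Main.v *)
(** With [d = r - 1], put [S = A + A^2 + ... + A^d].  Since [A^(d+1) = A], we
    have [S A = S], hence [S^2 = d S], and [A^d] is an idempotent of the same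
    rank as [A].  If [S] were entrywise positive, then [S] would have rank at
    most one, so [rank A = tr (A^d) <= tr S = d * rank S <= d], against the
    hypothesis on the rank.  So [S i j = 0] for some [i] and [j], and the
    support of the [i]-th row of [S] is closed under the directed graph of [A]
    and misses [j]; this support, or [{i}] if it is empty, is a proper closed
    set of indices of [A], and its product with all the indices of [B] is a
    proper closed set for [A *t B]. *)
Require Import Defs.
From mathcomp Require Import all_boot all_order all_algebra fingroup perm.
From mathcomp Require Import reals mxtens.

Set Implicit Arguments.
Unset Strict Implicit.
Unset Printing Implicit Defensive.

Import Order.TTheory GRing.Theory Num.Theory.

Local Open Scope ring_scope.

(** Write [M] as [col_base M *m row_base M]. Cancelling both full-rank factors in [M *m M = c *: M]
    leaves the reversed product equal to [c%:M], of size [\rank M] and of the same trace. *)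
Lemma mxtrace_scaled_idem (F : fieldType) n (M : 'M[F]_n) (c : F) :
  M *m M = c *: M -> \tr M = c * (\rank M)%:R.
Proof.
move=> MM; have RC : row_base M *m col_base M = c%:M.
  apply: (row_full_inj (col_base_full M)); apply: (row_free_inj (row_base_free M)).
  rewrite mul_mx_scalar -scalemxAl mulmx_base -MM -[in RHS](mulmx_base M).
  by rewrite !mulmxA.
by rewrite -{1}(mulmx_base M) mxtrace_mulC RC mxtrace_scalar mulr_natr.
Qed.

(** A Perron-type argument: the rows of [M] are left eigenvectors for [c], and positivity makes each
    a multiple of the first. *)
Lemma rank_pos_scaled_idem (F : realFieldType) n (M : 'M[F]_n) (c : F) :
  (forall i j, 0 < M i j) -> M *m M = c *: M -> (\rank M <= 1)%N.
Proof.
case: n M => [|n] M Mgt0 MM; first by rewrite (leq_trans (rank_leq_row _)).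
pose u := row ord0 M; have ugt0 j : 0 < u 0 j by rewrite mxE.
suff rowM i : (row i M <= u)%MS.
  by rewrite (leq_trans (mxrankS _) (rank_leq_row u)) //; apply/row_subP.
pose v := row i M.
(* The least ratio is the largest [t] that keeps [v - t *: u] nonnegative. *)
have [k _ kmin] := arg_minP (fun k => v 0 k / u 0 k)
  (erefl : xpredT (ord0 : 'I_n.+1)).
(* [w] is a nonnegative eigenvector with a zero entry, so it vanishes. *)
pose t := v 0 k / u 0 k; pose w := v - t *: u.
have w_ge0 l : 0 <= w 0 l.
  have -> : w 0 l = v 0 l - t * u 0 l by rewrite !mxE.
  by rewrite subr_ge0 -ler_pdivlMr // kmin.
have wk : w 0 k = 0.
  have -> : w 0 k = v 0 k - t * u 0 k by rewrite !mxE.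
  by rewrite /t divfK ?subrr // gt_eqF.
have wM : w *m M = c *: w.
  rewrite mulmxBl -scalemxAl -!row_mul MM !linearZ /= scalerBr !scalerA mulrC.
  by rewrite scalerN.
have /eqP : (w *m M) 0 k = 0 by rewrite wM mxE wk mulr0.
rewrite mxE psumr_eq0 => [/allP w0 | l _]; last by rewrite mulr_ge0 // ltW.
have -> : row i M = t *: u.
  apply/eqP; rewrite -subr_eq0; apply/eqP/rowP => l.
  move: (w0 l (mem_index_enum l)); rewrite mulf_eq0 (gt_eqF (Mgt0 l k)) orbF.
  by move=> /eqP wl; rewrite [LHS]wl mxE.
exact: scalemx_sub.
Qed.

Section PowerSum.
Variables (F : realFieldType) (n d : nat) (A : 'M[F]_n).
Hypotheses (A_ge0 : A \is a mxOver Num.nneg) (AdA : A ^+ d.+2 = A).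

(** Here [d] stands for [r - 2], so that [S] has [r - 1] terms. *)
Let S := \sum_(i < d.+1) A ^+ i.+1.

Lemma exp_mx_ge0 k i j : 0 <= (A ^+ k) i j.
Proof.
elim: k i j => [|k IHk] i j; first by rewrite expr0 mxE ler0n.
rewrite exprS -mulmxE mxE sumr_ge0 // => l _; rewrite mulr_ge0 //.
by have /mxOverP/(_ i l) := A_ge0; rewrite nnegrE.
Qed.

Lemma powersum_ge0 i j : 0 <= S i j.
Proof. by rewrite summxE sumr_ge0 // => k _; apply: exp_mx_ge0. Qed.

(** Multiplying by [A] shifts the powers cyclically: the last one becomes [A ^+ d.+2 = A]. *)
Lemma powersum_mulr : S *m A = S.
Proof.
rewrite mulmxE mulr_suml; under eq_bigr do rewrite -exprSr.
by rewrite big_ord_recr [RHS]big_ord_recl /= AdA expr1 addrC.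
Qed.

Lemma powersum_sqr : S *m S = d.+1%:R *: S.
Proof.
have SA k : S *m A ^+ k = S.
  elim: k => [|k IHk]; first by rewrite expr0 mulmx1.
  by rewrite exprSr -mulmxE mulmxA IHk powersum_mulr.
rewrite {2}/S mulmx_sumr (eq_bigr (fun=> S)) // sumr_const card_ord.
by rewrite scaler_nat.
Qed.

Lemma rank_le_of_powersum_gt0 : (forall i j, 0 < S i j) -> (\rank A <= d.+1)%N.
Proof.
move=> Sgt0; have EE : A ^+ d.+1 *m A ^+ d.+1 = 1 *: A ^+ d.+1.
  by rewrite scale1r mulmxE -exprD addSnnS addnC exprD AdA -exprS.
have rkA : (\rank A <= \rank (A ^+ d.+1))%N.
  by rewrite -{1}AdA exprSr -mulmxE mxrankM_maxl.
apply: leq_trans rkA _; rewrite -(ler_nat F).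
rewrite -[X in X <= _]mul1r -(mxtrace_scaled_idem EE).
apply: (@le_trans _ _ (\tr S)).
  rewrite /S big_ord_recr raddfD /= lerDr raddf_sum sumr_ge0 //= => i _.
  by rewrite sumr_ge0 // => j _; apply: exp_mx_ge0.
rewrite (mxtrace_scaled_idem powersum_sqr) -natrM ler_nat -[X in (_ <= X)%N]muln1.
by rewrite leq_mul2l (rank_pos_scaled_idem Sgt0 powersum_sqr) orbT.
Qed.

(** By [S *m A = S], the entry [S i l] is a sum of nonnegative terms [S i k * A k l], which vanish
    with it. *)
Lemma powersum_closed i k l : S i l = 0 -> 0 < S i k -> A k l = 0.
Proof.
move=> Sil Sik; have := congr1 (fun M : 'M_n => M i l) powersum_mulr.
rewrite mxE Sil => /eqP; rewrite psumr_eq0 => [/allP S0 | h _]; last first.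
  by rewrite mulr_ge0 ?powersum_ge0 // -[A]expr1 exp_mx_ge0.
by have := S0 k (mem_index_enum k); rewrite mulf_eq0 gt_eqF //= => /eqP.
Qed.

Lemma le_powersum i j : A i j <= S i j.
Proof.
rewrite summxE big_ord_recl /= expr1 lerDl sumr_ge0 // => k _.
exact: exp_mx_ge0.
Qed.

End PowerSum.

(** In the directed graph of [A], no edge leaves [T]. *)
Definition closed_set (R : realType) n (A : 'M[R]_n) (T : {set 'I_n}) : Prop :=
  forall k l, k \in T -> l \notin T -> A k l = 0.

Lemma rpotent_closed_set (R : realType) (r n : nat) (A : 'M[R]_n) :
    (2 <= r)%N -> A \is a mxOver Num.nneg -> rpotent r A ->
    (r - 1 < \rank A)%N ->
  exists T : {set 'I_n}, [/\ T != set0, T != setT & closed_set A T].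
Proof.
case: r => [|[|d]] // _ A_ge0; rewrite /rpotent => AdA rankA.
pose S := \sum_(i < d.+1) A ^+ i.+1.
have [i [j Sij]] : exists i, exists j, S i j = 0.
  have [/existsP[i /existsP[j /eqP Sij]]|] :=
    boolP [exists i, exists j, S i j == 0]; first by exists i, j.
  rewrite negb_exists => /forallP S_neq0.
  suff /(rank_le_of_powersum_gt0 A_ge0 AdA) : forall i j, 0 < S i j.
    by rewrite leqNgt -[d.+1]/(d.+2.-1) -subn1 rankA.
  move=> i j; rewrite lt0r powersum_ge0 // andbT.
  by have := S_neq0 i; rewrite negb_exists => /forallP.
pose T := [set k | 0 < S i k].
have S0 l : l \notin T -> S i l = 0.
  rewrite inE -leNgt => Sl; apply/eqP.
  by rewrite eq_le Sl powersum_ge0.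
have [T0|T_neq0] := eqVneq T set0; last first.
  exists T; split=> //.
    by apply/eqP => /setP/(_ j); rewrite !inE Sij ltxx.
  by move=> k l; rewrite inE => kT /S0 lT; apply: powersum_closed kT.
(* Row [i] of [S] is zero and dominates row [i] of [A], so no edge leaves [i]. *)
exists [set i]; split.
- by apply/set0Pn; exists i; rewrite inE.
(* Otherwise [A] has size 1, while its rank exceeds [r - 1 >= 1]. *)
- apply/eqP => i1; have := leq_trans rankA (rank_leq_row A).
  by rewrite -[n in (_ < n)%N]card_ord -cardsT -i1 cards1 subn1.
- move=> k l /set1P-> _; apply/eqP; rewrite eq_le -[X in _ <= X](S0 l) ?T0 ?inE //.
  by rewrite le_powersum //=; have /mxOverP/(_ i l) := A_ge0; rewrite nnegrE.
Qed.

Lemma decomposable_perm (R : realType) p q (A : 'M[R]_(p + q))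
    (s : 'S_(p + q)) :
    (0 < p)%N -> (0 < q)%N ->
    (forall i j, A (s (rshift p i)) (s (lshift q j)) = 0) ->
  decomposable A.
Proof.
(* The conjugating matrix is [perm_mx s^-1], with inverse [perm_mx s]. *)
move=> p_gt0 q_gt0 A0; pose M := perm_mx s *m A *m perm_mx s^-1.
have ME i j : M i j = A (s i) (s j).
  by rewrite /M -row_permE -col_permE !mxE.
have Ps : (perm_mx s : 'M[R]_(p + q)) *m perm_mx s^-1 = 1%:M.
  by rewrite -perm_mxM mulgV perm_mx1.
exists p, q, erefl, (perm_mx s^-1), (ulsubmx M), (ursubmx M), (drsubmx M).
split; rewrite ?perm_mx_is_perm // castmx_id.
have -> : invmx (perm_mx s^-1) = perm_mx s :> 'M[R]_(p + q).
  have [_ U] := mulmx1_unit Ps.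
  by rewrite -[RHS]mulmx1 -(mulmxV U) mulmxA Ps mul1mx.
rewrite -[LHS]/M -[LHS]submxK; congr block_mx.
by clearbody M; apply/matrixP=> i j; rewrite !mxE ME A0.
Qed.

(** Listing the complement of [T] first and [T] last moves the zero entries to the lower left
    block. *)
Lemma decomposable_closed_set (R : realType) n (A : 'M[R]_n) (T : {set 'I_n}) :
  T != set0 -> T != setT -> closed_set A T -> decomposable A.
Proof.
move=> T_neq0 T_neqT; have q_gt0 : (0 < #|T|)%N by rewrite card_gt0.
have p_gt0 : (0 < #|~: T|)%N.
  by rewrite card_gt0; apply: contraNneq T_neqT => T0; rewrite -[T]setCK T0 setC0.
have e : (#|~: T| + #|T| = n)%N by rewrite addnC cardsC card_ord.
(* The cardinals depend on [n] through [T]; they are named first so that [n] can be replaced by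
   [p + q]. *)
move: p_gt0 q_gt0 e => {T_neq0 T_neqT}; move Dp: #|~: T| => p.
move Dq: #|T| => q p_gt0 q_gt0 e; case: _ / e in A T Dp Dq * => A0.
pose f (k : 'I_(p + q)) := match split k with
  | inl i => enum_val (cast_ord (esym Dp) i)
  | inr j => enum_val (cast_ord (esym Dq) j) end.
have fl i : f (lshift q i) = enum_val (cast_ord (esym Dp) i).
  by rewrite /f (unsplitK (inl i)).
have fr j : f (rshift p j) = enum_val (cast_ord (esym Dq) j).
  by rewrite /f (unsplitK (inr j)).
have flT i : f (lshift q i) \notin T by rewrite fl -in_setC enum_valP.
have frT j : f (rshift p j) \in T by rewrite fr enum_valP.
have f_inj : injective f.
  move=> k l; rewrite -(splitK k) -(splitK l).
  case: (split k) (split l) => i [] j /= fE.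
  - by move: fE; rewrite !fl => /enum_val_inj/cast_ord_inj->.
  - by have := flT i; rewrite fE frT.
  - by have := frT i; rewrite fE (negPf (flT j)).
  - by move: fE; rewrite !fr => /enum_val_inj/cast_ord_inj->.
by apply: (@decomposable_perm _ p q A (perm f_inj)) => // i j; rewrite !permE A0.
Qed.

Lemma tensmx_exp (R : comPzRingType) m n (A : 'M[R]_m) (B : 'M[R]_n) k :
  (A *t B) ^+ k.+1 = A ^+ k.+1 *t B ^+ k.+1.
Proof.
elim: k => [|k IHk]; first by rewrite !expr1.
by rewrite exprS IHk -mulmxE tensmx_mul !mulmxE -!exprS.
Qed.

Lemma tensmx_closed_set (R : realType) m n (A : 'M[R]_m) (B : 'M[R]_n)
    (T : {set 'I_m}) :
  closed_set A T -> closed_set (A *t B) [set k | (mxtens_unindex k).1 \in T].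
Proof. by move=> A0 k l; rewrite !inE mxE => kT lT; rewrite A0 ?mul0r. Qed.

Theorem theorem5p2 (R : realType) (r m n : nat) (A : 'M[R]_m) (B : 'M[R]_n)
  (r_ge2 : (2 <= r)%N)
  (A_ge0 : A \is a mxOver Num.nneg)
  (A_rpotent : rpotent r A)
  (rankA : (r - 1 < \rank A)%N)
  (B_neq0 : B != 0)
  (B_ge0 : B \is a mxOver Num.nneg)
  (B_idem : idempotent_mx B) :
  decomposable (A *t B) /\ rpotent r (A *t B).
Proof.
split; last first.
  case: r r_ge2 A_rpotent {rankA} => [|r] // _; rewrite /rpotent tensmx_exp => ->.
  congr (_ *t _); elim: r => [|r IHr]; first by rewrite expr1.
  by rewrite exprS IHr -expr2 B_idem.
(* An index of [B] is needed for the product set to be nonempty and proper. *)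
have [b0 _] : exists b0 : 'I_n, True.
  case: n B B_neq0 {B_ge0 B_idem} => [|n] B B_neq0; last by exists ord0.
  by rewrite flatmx0 eqxx in B_neq0.
have [T [T_neq0 T_neqT T_closed]] :=
  rpotent_closed_set r_ge2 A_ge0 A_rpotent rankA.
apply: decomposable_closed_set (tensmx_closed_set B T_closed).
- have /set0Pn[a aT] := T_neq0; apply/set0Pn; exists (mxtens_index (a, b0)).
  by rewrite inE mxtens_indexK.
- apply: contraNneq T_neqT => /setP TT; apply/eqP/setP => a.
  by have := TT (mxtens_index (a, b0)); rewrite !inE mxtens_indexK.
Qed.
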